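(* Let $g\ge2$ be even, let $m\ge2$, and let $\varepsilon>0$, $\theta_\varepsilon=\varepsilon/(1+\varepsilon)$. The triple $\mathcal{V}^{(g)}_m=(1,g^m-1,g^m)$ is a parity-class triple. Moreover, $$E_\varepsilon(\mathcal{V}^{(g)}_m)=(1+\varepsilon)\Delta^{(g)}_m-\varepsilon m\log g-(1+\varepsilon)\log\bigl(R_g(1-g^{-m})\bigr).$$ Thus $E_\varepsilon(\mathcal{V}^{(g)}_m)\ge0$ holds precisely when $$\Delta^{(g)}_m\ \ge\ \theta_\varepsilon m\log g+\log\bigl(R_g(1-g^{-m})\bigr).$$ The defect admits the exact decomposition $$\Delta^{(g)}_m=\Omega^{(g)}_m+\log G^{(g)}_m,$$ in which $G^{(g)}_m$ is the largest divisor of $m$ all of whose prime factors divide $g^m-1$. In particular, $$0\le\Delta^{(g)}_m-\Omega^{(g)}_m\le\log\left(\frac m{2^{v_2(m)}}\right)\le\log m .$$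
   Context: A parity-class triple is a triple $(a,b,c)$ of pairwise coprime positive integers with $a+b=c$, $a$ and $b$ odd, $c$ even. $\mathrm{rad}(n)$ is the product of the distinct primes dividing $n$, $v_p$ is the $p$-adic valuation, and $E_\varepsilon(a,b,c)=\log c-(1+\varepsilon)\log\mathrm{rad}(abc)$. For even $g\ge2$ put $R_g=\mathrm{rad}(g)$ and $\Delta^{(g)}_m=\log\bigl((g^m-1)/\mathrm{rad}(g^m-1)\bigr)$. For a prime $p\nmid g$, let $d_{g,p}$ be the multiplicative order of $g$ modulo $p$ and $A_{g,p}=v_p(g^{d_{g,p}}-1)$. Let $\mathcal{W}_g=\{p\text{ prime},\ p\nmid g:\ g^{p-1}\equiv1\pmod{p^2}\}$ and $\mathcal{W}_g(m)=\{p\in\mathcal{W}_g:d_{g,p}\mid m\}$. Put $\Omega^{(g)}_m=\sum_{p\in\mathcal{W}_g(m)}(A_{g,p}-1)\log p$ (empty sum $=0$) and $G^{(g)}_m=\prod_{p\mid g^m-1}p^{v_p(m)}$ (product over primes). *)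

(* Defs.v *)
From HB Require Import structures.
From mathcomp Require Import all_boot all_order all_algebra all_fingroup all_solvable.
From mathcomp Require Import all_classical all_reals all_analysis.

Set Implicit Arguments.
Unset Strict Implicit.
Unset Printing Implicit Defensive.

Import Order.TTheory GRing.Theory Num.Theory.

Local Open Scope classical_set_scope.
Local Open Scope ring_scope.

Definition radical (n : nat) : nat := (\prod_(p <- primes n) p)%N.

Definition parity_class_triple (t : nat * nat * nat) : Prop :=
  let: (a, b, c) := t in
  [/\ [/\ (0 < a)%N, (0 < b)%N & (0 < c)%N],
      [/\ coprime a b, coprime a c & coprime b c],
      (a + b = c)%N &
      [/\ odd a, odd b & ~~ odd c]].

Definition Eps_excess (R : realType) (eps : R) (t : nat * nat * nat) : R :=
  let: (a, b, c) := t in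
  ln c%:R - (1 + eps) * ln (radical (a * b * c))%:R.

Definition theta (R : realType) (eps : R) : R := eps / (1 + eps).

Definition Vtriple (g m : nat) : nat * nat * nat :=
  (1%N, (g ^ m - 1)%N, (g ^ m)%N).

Definition Delta (R : realType) (g m : nat) : R :=
  ln ((g ^ m - 1)%N%:R / (radical (g ^ m - 1))%:R).

(* Only meaningful for p prime and p not dividing g: then g%:R is a unit of
   'F_p and insubd returns it; otherwise the default unit 1 is used. *)
Definition mult_order (g p : nat) : nat :=
  #[insubd (1%g : {unit 'F_p}) (g%:R : 'F_p)]%g.

Definition Aval (g p : nat) : nat := logn p (g ^ mult_order g p - 1).

Definition Wieferich (g : nat) : set nat :=
  [set p : nat | [/\ prime p, ~~ (p %| g)%N &
                     (g ^ (p - 1) = 1 %[mod p ^ 2])%N]].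

Definition Wieferich_at (g m : nat) : set nat :=
  [set p : nat | Wieferich g p /\ (mult_order g p %| m)%N].

(* p \in A with A : set nat is the finite-support sum of fsbigop, which is a
   genuine sum here because of finite_Wieferich_at below. *)
Definition Omega (R : realType) (g m : nat) : R :=
  \sum_(p \in Wieferich_at g m) ((Aval g p)%:R - 1) * ln (p%:R : R).

Definition Gpart (g m : nat) : nat :=
  (\prod_(p <- primes (g ^ m - 1)) p ^ logn p m)%N.

Lemma mult_order_dvdn (g p m : nat) : prime p -> ~~ (p %| g)%N ->
  (mult_order g p %| m)%N = (p %| g ^ m - 1)%N.
Proof.
move=> p_pr pNg; have g0 : (0 < g)%N by case: g pNg; rewrite ?dvdn0.
have gU : (g%:R : 'F_p) \is a GRing.unit.
  by rewrite unitfE -(dvdn_pcharf (pchar_Fp p_pr)).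
rewrite /mult_order order_dvdn -val_eqE /= FinRing.val_unitX val_insubd gU.
rewrite (dvdn_pcharf (pchar_Fp p_pr)) natrB ?expn_gt0 ?g0// natrX.
by rewrite subr_eq0.
Qed.

Lemma finite_Wieferich_at (g m : nat) : (1 < g)%N -> (0 < m)%N ->
  finite_set (Wieferich_at g m).
Proof.
move=> g1 m0; apply: (@sub_finite_set _ _ `I_(g ^ m)); last exact: finite_II.
move=> p [[p_pr pNg _]]; rewrite mult_order_dvdn// => pd /=.
have gm1 : (1 < g ^ m)%N by rewrite -{1}(exp1n m) ltn_exp2r.
have := dvdn_leq _ pd; rewrite subn_gt0 => /(_ gm1) /leq_ltn_trans; apply.
by rewrite subn1 prednK // ltnW.
Qed.

(* Main.v *)
Require Import Defs.
From HB Require Import structures.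
From mathcomp Require Import all_boot all_order all_algebra all_fingroup all_solvable.
From mathcomp Require Import all_classical all_reals all_analysis.
From mathcomp Require Import ring lra zify.

Set Implicit Arguments.
Unset Strict Implicit.
Unset Printing Implicit Defensive.

Import Order.TTheory GRing.Theory Num.Theory.

(** Everything beyond bookkeeping rests on one computation: for an odd prime p
    dividing g ^ m - 1, with d the order of g modulo p,
      v_p (g ^ m - 1) = v_p (g ^ d - 1) + v_p (m).
    Indeed g ^ m - 1 = x ^ (m / d) - 1 with x = g ^ d congruent to 1 modulo p,
    so lifting the exponent (logn_exp_sub1) gives the extra term v_p (m / d),
    and d divides p - 1 by Fermat, so p does not divide d and
    v_p (m / d) = v_p (m); this is logn_expn_sub1_Aval.  Since g is even,
    g ^ m - 1 is odd and coprime to g, so the formula covers all its prime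
    divisors.

    Writing A for v_p (g ^ d - 1), the defect is the sum of
    (v_p (g ^ m - 1) - 1) log p over the primes p dividing g ^ m - 1, hence the
    sum of (A - 1) log p plus the logarithm of the product of the p ^ v_p (m),
    which is Gpart g m.  The same formula at exponent p - 1, which p does not
    divide, shows that A = v_p (g ^ (p - 1) - 1), so the primes that are not
    Wieferich are exactly those with A = 1 and contribute nothing: the first
    sum is Omega (Omega_sum).

    Gpart g m is the part of m supported on the primes of g ^ m - 1
    (Gpart_part), which makes it the largest divisor of m of this kind; it is
    odd, hence divides the odd part of m, and this gives the final bounds.

    The formula for the excess uses that the radical is multiplicative on the
    coprime factors g ^ m - 1 and g ^ m, together with
    1 - g ^ (- m) = (g ^ m - 1) / g ^ m. *)

(** * Lifting the exponent at an odd prime *)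

Lemma expn_succ_mod2 (y n : nat) :
  exists c, (y + 1) ^ n = 1 + n * y + y ^ 2 * c.
Proof.
elim: n => [|n [c IH]]; first by exists 0; rewrite expn0 muln0 mul0n.
by exists (n + c + y * c); rewrite expnS IH; nia.
Qed.

(** Modulo the square of y, the term (1 + y) ^ i is 1 + i y; the binomial
    'C(n, 2) is the sum of the i < n.  Precision y ^ 2 is what valuation
    exactly 1 requires when p divides y. *)
Lemma geometric_sum_mod2 (y n : nat) :
  exists c, \sum_(i < n) (y + 1) ^ i = n + y * 'C(n, 2) + y ^ 2 * c.
Proof.
elim: n => [|n [c IH]]; first by exists 0; rewrite big_ord0 bin0n !muln0.
have [d Hd] := expn_succ_mod2 y n.
by exists (c + d); rewrite big_ord_recr /= IH Hd binS bin1; nia.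
Qed.

Lemma logn_geometric_sum_coprime (p x n : nat) : 0 < x -> p %| x - 1 ->
  ~~ (p %| n) -> logn p (\sum_(i < n) x ^ i) = 0.
Proof.
move=> x0 px pNn; apply/eqP; rewrite -leqn0 leqNgt logn_gt0 mem_primes.
apply: contra pNn => /and3P[_ _].
have [c] := geometric_sum_mod2 (x - 1) n; rewrite subnK// => ->.
by rewrite expnS expn1 -mulnA -addnA -mulnDr dvdn_addl// dvdn_mulr.
Qed.

(** The sum is p + (x - 1) 'C(p, 2) modulo p ^ 2.  Oddness of p makes p divide
    'C(p, 2), so the second term also vanishes modulo p ^ 2; for p = 2 and
    x = 3 the valuation is 2. *)
Lemma logn_geometric_sum_prime (p x : nat) : prime p -> odd p -> 0 < x ->
  p %| x - 1 -> logn p (\sum_(i < p) x ^ i) = 1.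
Proof.
move=> p_pr p_odd x0 /dvdnP[k xE].
have p0 := prime_gt0 p_pr.
have p2 : 2 < p by case: p p_odd p_pr {xE p0} => [|[|[|]]].
have [c] := geometric_sum_mod2 (x - 1) p; rewrite subnK// => ->.
have /dvdnP[b ->] : p %| 'C(p, 2) by apply: prime_dvd_bin.
rewrite xE.
have -> : p + k * p * (b * p) + (k * p) ^ 2 * c
        = p * (p * (k * b + k ^ 2 * c) + 1) by ring.
rewrite lognM//; last by rewrite addn1.
rewrite logn_prime// eqxx lognE dvdn_addr ?dvdn_mulr// dvdn1.
by rewrite gtn_eqF ?prime_gt1// !andbF.
Qed.

(** Lifting the exponent.  Each factor p of n is peeled off by passing from x to
    x ^ p, which raises the valuation by exactly one; what is left is an
    exponent prime to p, for which the cofactor of x - 1 is a unit modulo p. *)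
Lemma logn_exp_sub1 (p x n : nat) : prime p -> odd p -> 1 < x -> 0 < n ->
  p %| x - 1 -> logn p (x ^ n - 1) = logn p (x - 1) + logn p n.
Proof.
move=> p_pr p_odd; elim/ltn_ind: n x => n IH x x1 n0 px.
have x0 : 0 < x by apply: ltnW.
have geom k : 0 < k -> logn p (x ^ k - 1)
    = logn p (x - 1) + logn p (\sum_(i < k) x ^ i).
  move=> k0; rewrite !subn1 predn_exp lognM//; first by rewrite -subn1 subn_gt0.
  by case: k k0 => // k _; rewrite big_ord_recl.
have [/dvdnP[k nE]|pNn] := boolP (p %| n); last first.
  rewrite geom// logn_geometric_sum_coprime//.
  by congr addn; rewrite lognE (negbTE pNn) !andbF.
have k0 : 0 < k by case: k nE n0 => // ->.
rewrite nE mulnC expnM IH//.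
- rewrite geom ?prime_gt0// logn_geometric_sum_prime// -addnA; congr addn.
  by rewrite lognM ?(prime_gt0 p_pr)// (logn_prime p p_pr) eqxx.
- by rewrite nE -[X in X < _]muln1 ltn_pmul2l// prime_gt1.
- by rewrite -{1}(exp1n p) ltn_exp2r ?prime_gt0.
- by apply: dvdn_trans px _; rewrite !subn1 predn_exp dvdn_mulr.
Qed.

(** * Valuations of the numbers g ^ m - 1 *)

Lemma expn_sub1_gt0 (g m : nat) : 1 < g -> 0 < m -> 0 < g ^ m - 1.
Proof. by move=> g1 m0; rewrite subn_gt0 -{1}(exp1n m) ltn_exp2r. Qed.

Lemma coprime_expn_sub1 (g m : nat) : 0 < g -> 0 < m -> coprime (g ^ m - 1) g.
Proof.
move=> g0 m0; rewrite -(coprime_pexpr _ _ m0) coprime_sym subn1.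
by rewrite coprimenP ?expn_gt0 ?g0.
Qed.

Lemma odd_expn_sub1 (g m : nat) : 0 < g -> ~~ odd g -> 0 < m ->
  odd (g ^ m - 1).
Proof.
move=> g0 ge m0; rewrite oddB ?expn_gt0 ?g0// oddX (negbTE ge) orbF.
by case: m m0.
Qed.

Lemma prime_dvdn_expn_sub1 (g m p : nat) : 0 < g -> ~~ odd g -> 0 < m ->
  prime p -> p %| g ^ m - 1 -> odd p /\ ~~ (p %| g).
Proof.
move=> g0 ge m0 p_pr pN; split; first exact: dvdn_odd pN (odd_expn_sub1 g0 ge m0).
by rewrite -prime_coprime//; apply: coprime_dvdl pN (coprime_expn_sub1 g0 m0).
Qed.

Lemma mult_order_dvdn_pred (g p : nat) : prime p -> ~~ (p %| g) ->
  mult_order g p %| p - 1.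
Proof.
move=> p_pr pNg; rewrite mult_order_dvdn//.
have g0 : 0 < g by case: g pNg; rewrite ?dvdn0.
rewrite -eqn_mod_dvd ?expn_gt0 ?g0//; apply/eqP.
have cop : coprime g p by rewrite coprime_sym prime_coprime.
by have := Euler_exp_totient cop; rewrite totient_prime// subn1.
Qed.

(** The order divides p - 1, hence is smaller than p. *)
Lemma logn_mult_order (g p : nat) : prime p -> ~~ (p %| g) ->
  logn p (mult_order g p) = 0.
Proof.
move=> p_pr pNg; have dvd := mult_order_dvdn_pred p_pr pNg.
have p1 := prime_gt1 p_pr.
rewrite lognE; case: and3P => // -[_ _ pd].
have := dvdn_leq _ (dvdn_trans pd dvd); lia.
Qed.

(** The prime p divides g ^ d - 1 already, d being the order of g modulo p, so
    the exponent is lifted from d to m; passing from m / d to m in the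
    valuation is free because p does not divide d. *)
Lemma logn_expn_sub1_Aval (g m p : nat) : 1 < g -> 0 < m -> prime p -> odd p ->
  p %| g ^ m - 1 -> ~~ (p %| g) ->
  logn p (g ^ m - 1) = Aval g p + logn p m.
Proof.
move=> g1 m0 p_pr p_odd pN pNg.
have /dvdnP[k mE] : mult_order g p %| m by rewrite mult_order_dvdn.
have [k0 d0] : 0 < k /\ 0 < mult_order g p.
  by apply/andP; rewrite -muln_gt0 -mE.
rewrite mE mulnC expnM logn_exp_sub1//.
- by rewrite lognM// logn_mult_order.
- by rewrite -{1}(exp1n (mult_order g p)) ltn_exp2r.
- by rewrite -mult_order_dvdn.
Qed.

Lemma Aval_gt0 (g p : nat) : 1 < g -> prime p -> ~~ (p %| g) -> 0 < Aval g p.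
Proof.
move=> g1 p_pr pNg; rewrite /Aval logn_gt0 mem_primes p_pr expn_sub1_gt0//=.
  by rewrite -mult_order_dvdn.
exact: order_gt0.
Qed.

(** Taking the exponent p - 1, prime to p, in the valuation formula shows that
    the Fermat quotient sees exactly the valuation at the order of g. *)
Lemma Wieferich_Aval (g p : nat) : 1 < g -> prime p -> odd p -> ~~ (p %| g) ->
  Wieferich g p <-> 1 < Aval g p.
Proof.
move=> g1 p_pr p_odd pNg.
have p1 : 0 < p - 1 by rewrite subn_gt0 prime_gt1.
have AE : logn p (g ^ (p - 1) - 1) = Aval g p.
  rewrite logn_expn_sub1_Aval// -?mult_order_dvdn ?mult_order_dvdn_pred//.
  rewrite [logn p (p - 1)]lognE; case: and3P => [[_ _ /(dvdn_leq p1)]|]; lia.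
have E : (g ^ (p - 1) == 1 %[mod p ^ 2]) = (1 < Aval g p).
  by rewrite eqn_mod_dvd ?expn_gt0 ?(ltnW g1)// pfactor_dvdn ?expn_sub1_gt0// AE.
by rewrite -E; split => [[_ _ /eqP]|/eqP].
Qed.

(** * Products over the primes dividing an integer *)

(** Used with m = n, where it is the factorization of n, and with
    n = g ^ m - 1, where the left-hand side is Gpart g m. *)
Lemma prod_primes_part (m n : nat) : 0 < m -> 0 < n ->
  \prod_(p <- primes n) p ^ logn p m = m`_(\pi(n)).
Proof.
move=> m0 n0; rewrite (@widen_partn (m + n)) ?leq_addr// -[RHS]big_filter.
apply: perm_big; apply: uniq_perm; rewrite ?primes_uniq ?filter_uniq ?iota_uniq//.
move=> p; rewrite mem_filter mem_index_iota /= andb_idr// mem_primes.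
by case/and3P=> _ _ /(dvdn_leq n0) pn; rewrite ltnS (leq_trans pn) ?leq_addl.
Qed.

Lemma Gpart_part (g m : nat) : 1 < g -> 0 < m ->
  Gpart g m = m`_(\pi(g ^ m - 1)).
Proof. by move=> g1 m0; rewrite -prod_primes_part// expn_sub1_gt0. Qed.

Lemma radical_gt0 (n : nat) : 0 < radical n.
Proof.
by rewrite /radical big_seq; apply: prodn_cond_gt0 => p;
  rewrite mem_primes => /andP[/prime_gt0].
Qed.

Lemma radicalM (a b : nat) : 0 < a -> 0 < b -> coprime a b ->
  radical (a * b) = radical a * radical b.
Proof.
move=> a0 b0 cop; rewrite /radical -big_cat; apply: perm_big.
apply: uniq_perm; rewrite ?primes_uniq//; last first.
  by move=> p; rewrite mem_cat primesM.
rewrite cat_uniq !primes_uniq andbT /=; apply/hasPn => p.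
rewrite !mem_primes => /and3P[p_pr _ pb]; rewrite p_pr a0 /=.
by rewrite -prime_coprime//; apply: coprime_dvdl pb _; rewrite coprime_sym.
Qed.

Lemma radicalX (n k : nat) : 0 < k -> radical (n ^ k) = radical n.
Proof. by move=> k0; rewrite /radical primesX. Qed.

Local Open Scope classical_set_scope.
Local Open Scope ring_scope.

Lemma ln_prod_primes (R : realType) (n : nat) (f : nat -> nat) :
  ln (\prod_(p <- primes n) p ^ f p)%N%:R
  = \sum_(p <- primes n) (f p)%:R * ln p%:R :> R.
Proof.
rewrite -[LHS](_ : ln (\prod_(p <- primes n) (p%:R : R) ^+ f p) = _); last first.
  by rewrite natr_prod; congr ln; apply: eq_bigr => p _; rewrite natrX.
have: all prime (primes n) by apply/allP => p; rewrite mem_primes => /andP[].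
elim: (primes n) => [|p s IH] /=; first by rewrite !big_nil ln1.
move=> /andP[p_pr s_pr]; rewrite !big_cons -(IH s_pr).
have p0 : 0 < p%:R :> R by rewrite ltr0n prime_gt0.
rewrite lnM ?posrE ?exprn_gt0 ?lnXn ?mulr_natl//.
rewrite big_seq; apply: prodr_gt0 => q /(allP s_pr) q_pr.
by rewrite exprn_gt0// ltr0n prime_gt0.
Qed.

(** * The decomposition of the defect *)

Lemma Delta_sum (R : realType) (g m : nat) : (1 < g)%N -> (0 < m)%N ->
  Delta R g m = \sum_(p <- primes (g ^ m - 1))
                  ((logn p (g ^ m - 1))%:R - 1) * ln p%:R.
Proof.
move=> g1 m0; rewrite /Delta; have := expn_sub1_gt0 g1 m0.
set N := (g ^ m - 1)%N => N0.
rewrite ln_div ?posrE ?ltr0n ?radical_gt0//.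
rewrite -{1}(part_pnat_id (pnat_pi N0)) -prod_primes_part// ln_prod_primes.
have -> : radical N = (\prod_(p <- primes N) p ^ 1)%N.
  by apply: eq_bigr => p _; rewrite expn1.
rewrite ln_prod_primes -sumrB; by apply: eq_bigr => p _; rewrite mulrBl.
Qed.

(** Extending the sum from the Wieferich primes to all the primes dividing
    g ^ m - 1 only adds terms with Aval g p = 1, which vanish. *)
Lemma Omega_sum (R : realType) (g m : nat) : (1 < g)%N -> ~~ odd g ->
  (0 < m)%N ->
  Omega R g m = \sum_(p <- primes (g ^ m - 1)) ((Aval g p)%:R - 1) * ln p%:R.
Proof.
move=> g1 ge m0; rewrite /Omega [RHS]fsbig_seq ?primes_uniq//.
apply: fsbig_widen => [p [[p_pr pNg _]]|p []] /=.
  by rewrite mult_order_dvdn// mem_primes p_pr expn_sub1_gt0.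
rewrite mem_primes => /and3P[p_pr _ pN] notW.
have [p_odd pNg] := prime_dvdn_expn_sub1 (ltnW g1) ge m0 p_pr pN.
suff -> : Aval g p = 1%N by rewrite subrr mul0r.
apply/eqP; rewrite eqn_leq Aval_gt0// andbT leqNgt; apply/negP => A1.
by apply: notW; split; [exact/Wieferich_Aval | rewrite mult_order_dvdn].
Qed.

Lemma Delta_decomposition (R : realType) (g m : nat) : (1 < g)%N -> ~~ odd g ->
  (0 < m)%N -> Delta R g m = Omega R g m + ln (Gpart g m)%:R.
Proof.
move=> g1 ge m0; rewrite Delta_sum// Omega_sum// ln_prod_primes -big_split /=.
rewrite big_seq [RHS]big_seq; apply: eq_bigr => p.
rewrite mem_primes => /and3P[p_pr _ pN].
have [p_odd pNg] := prime_dvdn_expn_sub1 (ltnW g1) ge m0 p_pr pN.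
by rewrite logn_expn_sub1_Aval// natrD; ring.
Qed.

(** * The triple and its excess *)

Lemma Vtriple_parity_class (g m : nat) : (1 < g)%N -> ~~ odd g -> (0 < m)%N ->
  parity_class_triple (Vtriple g m).
Proof.
move=> g1 ge m0; have g0 := ltnW g1; have gm0 : (0 < g ^ m)%N by rewrite expn_gt0 g0.
have N0 := expn_sub1_gt0 g1 m0; split.
- by [].
- by rewrite !coprime1n; split; rewrite // coprimeXr// coprime_expn_sub1.
- by rewrite subnKC.
- by split; rewrite // ?odd_expn_sub1// oddX negb_or -lt0n m0.
Qed.

Lemma Eps_excess_Vtriple (R : realType) (g m : nat) (eps : R) :
  (1 < g)%N -> (0 < m)%N ->
  Eps_excess eps (Vtriple g m)
    = (1 + eps) * Delta R g m - eps * m%:R * ln g%:R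
      - (1 + eps) * ln ((radical g)%:R * (1 - g%:R ^- m)).
Proof.
move=> g1 m0; have g0 := ltnW g1; have N0 := expn_sub1_gt0 g1 m0.
have gR0 : 0 < g%:R :> R by rewrite ltr0n.
have gm0 : (0 < g ^ m)%N by rewrite expn_gt0 g0.
have -> : 1 - g%:R ^- m = (g ^ m - 1)%N%:R / g%:R ^+ m :> R.
  by rewrite natrB// natrX mulrBl mul1r divff// expf_neq0// gt_eqF.
rewrite /Eps_excess /Vtriple /Delta mul1n radicalM// ?radicalX//; last first.
  by rewrite coprimeXr// coprime_expn_sub1.
rewrite natrM natrX !(ln_div, lnM) ?posrE ?divr_gt0 ?ltr0n ?radical_gt0 ?exprn_gt0//.
by rewrite lnXn// -[ln _ *+ m]mulr_natl; ring.
Qed.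

(** The excess is 1 + eps times the difference of the two sides. *)
Lemma Eps_excess_Vtriple_ge0 (R : realType) (g m : nat) (eps : R) :
  (1 < g)%N -> (0 < m)%N -> 0 < eps ->
  0 <= Eps_excess eps (Vtriple g m) <->
   theta eps * m%:R * ln g%:R + ln ((radical g)%:R * (1 - g%:R ^- m))
     <= Delta R g m.
Proof.
move=> g1 m0 e0; rewrite Eps_excess_Vtriple//; set L := ln (_ * _).
have e1 : 0 < 1 + eps by rewrite ltr_wpDl.
have -> : (1 + eps) * Delta R g m - eps * m%:R * ln g%:R - (1 + eps) * L
  = (1 + eps) * (Delta R g m - (theta eps * m%:R * ln g%:R + L)).
  by rewrite /theta; field; rewrite gt_eqF.
by rewrite pmulr_rge0// subr_ge0.
Qed.

(** * Extremality and size of Gpart *)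

Lemma Gpart_largest (g m : nat) : (1 < g)%N -> (0 < m)%N ->
  [/\ (Gpart g m %| m)%N,
      (forall q : nat, prime q -> (q %| Gpart g m)%N -> (q %| g ^ m - 1)%N) &
      (forall d : nat, (d %| m)%N ->
         (forall q : nat, prime q -> (q %| d)%N -> (q %| g ^ m - 1)%N) ->
         (d <= Gpart g m)%N)].
Proof.
move=> g1 m0; have N0 := expn_sub1_gt0 g1 m0; rewrite Gpart_part//; split.
- exact: dvdn_part.
- move=> q q_pr /(pnatP _ (part_gt0 _ _) (part_pnat _ _)) - /(_ q_pr).
  by rewrite /= mem_primes => /and3P[].
- move=> d dm dP; apply: dvdn_leq; first exact: part_gt0.
  have d0 : (0 < d)%N by exact: dvdn_gt0 dm.
  rewrite -(@part_pnat_id \pi((g ^ m - 1)%N) d) ?partn_dvd//.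
  by apply/pnatP => // q q_pr /(dP _ q_pr) qN; rewrite /= mem_primes q_pr N0.
Qed.

(** As g is even, 2 does not divide g ^ m - 1. *)
Lemma Gpart_dvdn_odd_part (g m : nat) : (1 < g)%N -> ~~ odd g -> (0 < m)%N ->
  (Gpart g m %| m`_2^')%N.
Proof.
move=> g1 ge m0; rewrite Gpart_part//; apply: sub_in_partn => p _.
rewrite /= mem_primes => /and3P[_ _ pN]; rewrite !inE.
by apply: contraTneq pN => ->; rewrite dvdn2 odd_expn_sub1 ?(ltnW g1).
Qed.

Theorem theorem6p15 (R : realType) (g m : nat) (eps : R)
    (g_ge2 : (2 <= g)%N) (g_even : ~~ odd g) (m_ge2 : (2 <= m)%N)
    (eps_gt0 : 0 < eps) :
  parity_class_triple (Vtriple g m) /\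
  Eps_excess eps (Vtriple g m)
    = (1 + eps) * Delta R g m - eps * m%:R * ln g%:R
      - (1 + eps) * ln ((radical g)%:R * (1 - g%:R ^- m)) /\
  (0 <= Eps_excess eps (Vtriple g m) <->
   theta eps * m%:R * ln g%:R + ln ((radical g)%:R * (1 - g%:R ^- m))
     <= Delta R g m) /\
  Delta R g m = Omega R g m + ln (Gpart g m)%:R /\
  [/\ (Gpart g m %| m)%N,
      (forall q : nat, prime q -> (q %| Gpart g m)%N -> (q %| g ^ m - 1)%N) &
      (forall d : nat, (d %| m)%N ->
         (forall q : nat, prime q -> (q %| d)%N -> (q %| g ^ m - 1)%N) ->
         (d <= Gpart g m)%N)] /\
  [/\ 0 <= Delta R g m - Omega R g m,
      Delta R g m - Omega R g m <= ln (m%:R / (2 ^ logn 2 m)%N%:R) &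
      ln (m%:R / (2 ^ logn 2 m)%N%:R) <= ln (m%:R : R)].
Proof.
have m0 : (0 < m)%N by apply: ltnW.
have G0 : (0 < Gpart g m)%N by rewrite Gpart_part// part_gt0.
split; first exact: Vtriple_parity_class.
split; first exact: Eps_excess_Vtriple.
split; first exact: Eps_excess_Vtriple_ge0.
split; first exact: Delta_decomposition.
split; first exact: Gpart_largest.
have -> : m%:R / (2 ^ logn 2 m)%N%:R = (m`_2^')%N%:R :> R.
  by rewrite -{1}(partnC 2%N m0) p_part natrM mulrC mulKf.
rewrite Delta_decomposition// addrC addKr; split.
- by rewrite ln_ge0// ler1n.
- rewrite ler_ln ?posrE ?ltr0n ?part_gt0// ler_nat.
  by rewrite dvdn_leq ?part_gt0// Gpart_dvdn_odd_part.
- by rewrite ler_ln ?posrE ?ltr0n ?part_gt0// ler_nat dvdn_leq// dvdn_part.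
Qed.
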